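(* Let $K$ be a triangulation of an open domain in $\mathbb{C}$ whose 1-skeleton $K^{(1)}$ is recurrent. If $\mathcal{P}$ and $\mathcal{Q}$ are circle packings for $K$ with $\Theta_{\mathcal{P}}\equiv\Theta_{\mathcal{Q}}$, then either both the ratio function from $\mathcal{P}$ to $\mathcal{Q}$ and the ratio function from $\mathcal{Q}$ to $\mathcal{P}$ are unbounded, or both are constant.
   Context: $K$ is a simplicial 2-complex given by a triangulation of a domain in $\mathbb{C}$ (connected open set), infinite and without boundary, oriented by the orientation of $\mathbb{C}$, with vertex set $K^{(0)}$, edge set $K^{(1)}$ (also denoting the 1-skeleton graph), and face set $K^{(2)}$; every vertex has finitely many neighbors. A circle packing for $K$ is a collection $\mathcal{P}=\{C_{\mathcal{P}}(v)\}_{v\in K^{(0)}}$ of circles in $\mathbb{C}$ indexed by the vertices such that $\langle C_{\mathcal{P}}(u),C_{\mathcal{P}}(v),C_{\mathcal{P}}(w)\rangle$ is a positively oriented triple of mutually externally tangent circles whenever $\langle u,v,w\rangle\in K^{(2)}$ is a positively oriented triple (no global disjointness of the circles is required). Its radius function is $r_{\mathcal{P}}(v):=$ radius of $C_{\mathcal{P}}(v)$. The map $S_{\mathcal{P}}$ sends each $v\in K^{(0)}$ to the center of $C_{\mathcal{P}}(v)$ and is extended affinely to edges and faces; the carrier $\mathrm{carr}(\mathcal{P})=S_{\mathcal{P}}(K)$ is the underlying geometric complex of $\mathcal{P}$, isomorphic to $K$ (when the packing is not univalent, it is regarded as an abstract surface made of the euclidean triangles $S_{\mathcal{P}}(\triangle)$,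 not as a subset of $\mathbb{C}$). The angle sum $\Theta_{\mathcal{P}}(v)$ at $v$ is the sum, over all faces $\triangle$ containing $v$, of the angle at $S_{\mathcal{P}}(v)$ in the euclidean triangle $S_{\mathcal{P}}(\triangle)$. The ratio function (ratio map) from $\mathcal{P}$ to $\mathcal{Q}$ is the function $f^{\#}:\mathrm{carr}(\mathcal{P})\to(0,\infty)$ given at vertices by $f^{\#}(S_{\mathcal{P}}(v)):=r_{\mathcal{Q}}(v)/r_{\mathcal{P}}(v)$ and extended affinely to edges and faces. A graph is recurrent if its simple random walk is recurrent, i.e. visits every vertex infinitely many times with probability 1. *)

(* Defs.v *)
From HB Require Import structures.
From mathcomp Require Import all_boot all_order all_algebra finmap.
From mathcomp Require Import complex.
From mathcomp Require Import all_classical all_reals all_analysis.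

Set Implicit Arguments.
Unset Strict Implicit.
Unset Printing Implicit Defensive.

Import Order.TTheory GRing.Theory Num.Theory.
Import numFieldNormedType.Exports.

Local Open Scope classical_set_scope.
Local Open Scope ring_scope.
Local Open Scope complex_scope.

(* The ascription to numFieldType gives [R[i]] the topology of its norm. *)
Definition plane (R : realType) : numFieldType := R[i].

(* [face u v w] says that {u, v, w} is a 2-simplex and that <u, v, w> is a
   positively oriented ordering of it.  A face is determined by its vertex
   set, and [face_asym] says that only one of its two cyclic orderings is
   positive.  The edges are the sides of the faces: the complex is pure. *)
Record oriented_complex (V : choiceType) := OrientedComplex {
  face :> V -> V -> V -> Prop;
  face_neq : forall u v w, face u v w -> u <> v;
  face_rot : forall u v w, face u v w -> face v w u;
  face_asym : forall u v w, face u v w -> ~ face v u w;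
  face_cover : forall u, exists v w, face u v w
}.

Definition edge (V : choiceType) (K : oriented_complex V) (u v : V) : Prop :=
  exists w, K u v w \/ K v u w.

(* The points of |K|, as barycentric coordinates.  When K is locally finite
   the topology of |K| is that of pointwise convergence of coordinates. *)
Definition realization (R : realType) (V : choiceType)
    (K : oriented_complex V) : set {ptws V -> R} :=
  [set x | (forall v, 0 <= x v) /\
     exists u v w, [/\ K u v w, x u + x v + x w = 1 &
       forall s, s <> u -> s <> v -> s <> w -> x s = 0]].

Definition vertex_pt (R : realType) (V : choiceType) (u : V) :
    {ptws V -> R} := fun s => (s == u)%:R.

Definition segment_pt (R : realType) (V : choiceType) (u v : V) (t : R) :
    {ptws V -> R} :=
  fun s => (1 - t) * vertex_pt R u s + t * vertex_pt R v s.

Definition barycenter (R : realType) (V : choiceType) (u v w : V) :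
    {ptws V -> R} :=
  fun s => (vertex_pt R u s + vertex_pt R v s + vertex_pt R w s) / 3%:R.

(* [a] is the variation of the argument of [g t - p] for t from 0 to 1. *)
Definition arg_variation (R : realType) (p : plane R) (g : R -> plane R)
    (a : R) : Prop :=
  exists theta : R -> R,
    [/\ {within `[0, 1]%classic, continuous theta},
        forall t, 0 <= t <= 1 ->
          g t - p = `|g t - p| * (cos (theta t) +i* sin (theta t)) &
        theta 1 - theta 0 = a].

(* The image of the boundary of the triangle, run through in the order
   u, v, w, has winding number 1 around the image of the barycenter. *)
Definition positive_image (R : realType) (V : choiceType)
    (phi : {ptws V -> R} -> plane R) (u v w : V) : Prop :=
  exists a b c : R,
    [/\ arg_variation (phi (barycenter R u v w)) (phi \o segment_pt u v) a,
        arg_variation (phi (barycenter R u v w)) (phi \o segment_pt v w) b,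
        arg_variation (phi (barycenter R u v w)) (phi \o segment_pt w u) c &
        a + b + c = pi *+ 2].

Definition homeomorphism_between (T U : topologicalType) (A : set T)
    (B : set U) (f : T -> U) : Prop :=
  exists g : U -> T,
    [/\ {within A, continuous f}, {within B, continuous g},
        (forall x, A x -> B (f x) /\ g (f x) = x) &
        (forall y, B y -> A (g y) /\ f (g y) = y)].

Definition locally_finite (V : choiceType) (adj : V -> V -> Prop) : Prop :=
  forall v, finite_set [set u | adj v u].

(* Each edge is in exactly two faces; as K is coherently oriented, one of
   them contains the edge as <u, v> and the other one as <v, u>. *)
Definition no_boundary (V : choiceType) (K : oriented_complex V) : Prop :=
  forall u v, edge K u v -> exists! w, K u v w.

(* K is given by a triangulation of the domain D of the plane, and is oriented
   by the orientation of the plane. *)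
Definition triangulation (R : realType) (V : choiceType)
    (K : oriented_complex V) (D : set (plane R)) : Prop :=
  [/\ open D, connected D &
    [/\ infinite_set [set: V], locally_finite (edge K), no_boundary K &
      exists phi : {ptws V -> R} -> plane R,
        homeomorphism_between (realization K) D phi /\
        forall u v w, K u v w -> positive_image phi u v w]].

Definition degree (V : choiceType) (adj : V -> V -> Prop) (v : V) : nat :=
  #|` fset_set [set u | adj v u] |.

Definition srw_step (R : realType) (V : choiceType) (adj : V -> V -> Prop)
    (u v : V) : R :=
  if `[< adj u v >] then (degree adj u)%:R^-1 else 0.

Definition simple_random_walk (R : realType) (V : choiceType)
    (adj : V -> V -> Prop) (v : V) (d : measure_display)
    (T : measurableType d) (P : probability T R) (X : nat -> T -> V) : Prop :=
  (forall n u, measurable (X n @^-1` [set u])) /\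
  forall (n : nat) (x : nat -> V),
    P [set t | forall i, (i <= n)%N -> X i t = x i] =
    ((x 0%N == v)%:R * \prod_(i < n) srw_step R adj (x i) (x i.+1))%:E.

(* The law of the simple random walk started at a vertex is determined by the
   path probabilities, so it does not matter which realization is chosen. *)
Definition recurrent (R : realType) (V : choiceType) (adj : V -> V -> Prop) :
    Prop :=
  forall v, exists (d : measure_display) (T : measurableType d)
      (P : probability T R) (X : nat -> T -> V),
    simple_random_walk adj v P X /\
    {ae P, forall t, forall u (N : nat), exists2 n, (N <= n)%N & X n t = u}.

Record circle (R : realType) := Circle {
  center : plane R;
  radius : R;
  radius_gt0 : 0 < radius
}.

Definition externally_tangent (R : realType) (c d : circle R) : Prop :=
  `|center c - center d| = (radius c + radius d)%:C.

Definition positive_triple (R : realType) (a b c : plane R) : Prop :=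
  0 < complex.Im ((b - a)^* * (c - a)).

Definition circle_packing (R : realType) (V : choiceType)
    (K : oriented_complex V) (P : V -> circle R) : Prop :=
  forall u v w, K u v w ->
    [/\ externally_tangent (P u) (P v), externally_tangent (P v) (P w),
        externally_tangent (P w) (P u) &
        positive_triple (center (P u)) (center (P v)) (center (P w))].

(* Angle at [a] of the euclidean triangle a b c. *)
Definition angle (R : realType) (a b c : plane R) : R :=
  acos (complex.Re ((b - a)^* * (c - a)) /
        complex.Re (`|b - a| * `|c - a|)).

(* Each face containing v is <v, p.1, p.2> for exactly one pair p. *)
Definition angle_sum (R : realType) (V : choiceType) (K : oriented_complex V)
    (P : V -> circle R) (v : V) : R :=
  \sum_(p \in [set p : V * V | K v p.1 p.2])
     angle (center (P v)) (center (P p.1)) (center (P p.2)).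

Definition S_map (R : realType) (V : choiceType) (P : V -> circle R)
    (x : {ptws V -> R}) : plane R :=
  \sum_(v \in [set: V]) (x v)%:C * center (P v).

(* The abstract surface made of the triangles S_P(T): a point of it is a point
   of the plane together with its barycentric coordinates, so that triangles
   which overlap in the plane are not identified. *)
Definition carrier (R : realType) (V : choiceType) (K : oriented_complex V)
    (P : V -> circle R) : set ({ptws V -> R} * plane R) :=
  [set p | realization K p.1 /\ p.2 = S_map P p.1].

Definition ratio_map (R : realType) (V : choiceType) (P Q : V -> circle R)
    (p : {ptws V -> R} * plane R) : R :=
  \sum_(v \in [set: V]) p.1 v * (radius (Q v) / radius (P v)).

Definition constant_on (T U : Type) (A : set T) (f : T -> U) : Prop :=
  exists c, forall x, A x -> f x = c.

(* Main.v *)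
(* Put phi = ln (r_Q / r_P).  Moving the logarithms of the radii along a
   segment from P to Q, the angles of a triangle vary by symmetric weights
   [conductance] which lie between 0 and 1/2, so each edge carries total weight
   at most 1: equality of the angle sums says that phi is harmonic for bounded
   conductances.  If phi < C, then h = C - phi is a positive harmonic function,
   and testing against g^2 / h (Picone) gives, on every edge xy, a bound of
   (g x / h x - g y / h y)^2 by the Dirichlet energy of g.  For g take the
   probability of hitting a vertex o within k steps of the simple random walk:
   it has finite support, it is subharmonic off o, so its energy is at most
   2 deg(o) (1 - (mean of g around o)), and by recurrence g tends to 1 while
   the energy tends to 0.  Hence h is constant. *)

Require Import Defs.
From HB Require Import structures.
From mathcomp Require Import all_boot all_order all_algebra finmap.
From mathcomp Require Import complex.
From mathcomp Require Import all_classical all_reals all_analysis.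
From mathcomp Require Import ring lra.

Set Implicit Arguments.
Unset Strict Implicit.
Unset Printing Implicit Defensive.

Import Order.TTheory GRing.Theory Num.Theory.
Import numFieldNormedType.Exports.

Local Open Scope classical_set_scope.
Local Open Scope ring_scope.

(** * The angles of three mutually tangent circles *)

(* Law of cosines in the triangle with sides x + y, x + z, y + z. *)
Definition tangent_angle (R : realType) (x y z : R) : R :=
  acos (1 - 2 * y * z / ((x + y) * (x + z))).

(* Inradius of the triangle with sides x + y, y + z, z + x, divided by the
   length of the side x + y. *)
Definition conductance (R : realType) (x y z : R) : R :=
  Num.sqrt (x * y * z / (x + y + z)) / (x + y).

Lemma conductanceC (R : realType) (x y z : R) :
  conductance x y z = conductance y x z.
Proof. by rewrite /conductance [y + x]addrC [y * x]mulrC. Qed.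

Lemma is_derive_tangent_angle (R : realType) (x y z : R -> R)
    (t dx dy dz : R) :
  0 < x t -> 0 < y t -> 0 < z t ->
  is_derive t 1 x (x t * dx) -> is_derive t 1 y (y t * dy) ->
  is_derive t 1 z (z t * dz) ->
  is_derive t 1 (fun s => tangent_angle (x s) (y s) (z s))
    (conductance (x t) (y t) (z t) * (dy - dx) +
     conductance (x t) (z t) (y t) * (dz - dx)).
Proof.
move=> x0 y0 z0 Dx Dy Dz.
have xy0 : 0 < x t + y t by exact: addr_gt0.
have xz0 : 0 < x t + z t by exact: addr_gt0.
have xyz0 : 0 < x t + y t + z t by exact: addr_gt0.
pose c s := 1 - 2 * y s * z s / ((x s + y s) * (x s + z s)).
have Dc : is_derive t 1 c
    (- (2 * x t * y t * z t) / ((x t + y t) * (x t + z t)) *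
      ((dy - dx) / (x t + y t) + (dz - dx) / (x t + z t))).
  have n0 : ((x + y) * (x + z)) t != 0.
    by rewrite /GRing.mul /=; apply: mulf_neq0; apply: lt0r_neq0.
  have := is_deriveB (is_derive_cst (1 : R) t 1)
    (is_deriveM (is_deriveM (is_deriveZ 2 Dy) Dz)
      (is_deriveV n0 (is_deriveM (is_deriveD Dx Dy) (is_deriveD Dx Dz)))).
  move/is_derive_eq; apply.
  rewrite /GRing.scale /= sub0r.
  rewrite -[((x + y) * (x + z)) t]/((x t + y t) * (x t + z t)).
  rewrite -[(2 \*: y * z) t]/(2 * y t * z t).
  rewrite -[2 *: y t]/(2 * y t) -[(x + y) t]/(x t + y t).
  rewrite -[(x + z) t]/(x t + z t).
  by field; rewrite !lt0r_neq0.
(* By Heron's formula [s] is the area of the triangle, whose semiperimeter is x + y + z. Below, [c2]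
   says that the sine of the angle is twice the area over the product of the adjacent sides, and
   [hE] that the inradius is the area over the semiperimeter. *)
pose s := Num.sqrt (x t * y t * z t * (x t + y t + z t)).
have S0 : 0 < x t * y t * z t * (x t + y t + z t) by rewrite !mulr_gt0.
have s0 : 0 < s by rewrite sqrtr_gt0.
have sE : s ^+ 2 = x t * y t * z t * (x t + y t + z t).
  by rewrite sqr_sqrtr // ltW.
have c2 : 1 - c t ^+ 2 = (2 * s / ((x t + y t) * (x t + z t))) ^+ 2.
  rewrite !exprMn sE /c; field.
  by rewrite !lt0r_neq0.
have c1 : -1 < c t < 1.
  rewrite -ltr_norml -(@ltr_pXn2r _ 2) ?nnegrE // expr1n real_normK ?num_real //.
  by rewrite -subr_gt0 c2 exprn_gt0 // divr_gt0 ?mulr_gt0.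
have := is_derive1_comp (is_derive1_acos c1) Dc.
move/is_derive_eq; apply.
rewrite c2 sqrtr_sqr gtr0_norm; last by rewrite divr_gt0 ?mulr_gt0.
have hE : Num.sqrt (x t * y t * z t / (x t + y t + z t)) = s / (x t + y t + z t).
  apply/eqP; rewrite -(@eqrXn2 _ 2) ?sqrtr_ge0 ?divr_ge0 ?ltW //.
  rewrite sqr_sqrtr ?ltW ?divr_gt0 ?mulr_gt0 // exprMn sE.
  by apply/eqP; field; rewrite lt0r_neq0.
rewrite /conductance [x t + z t + y t]addrAC [x t * z t * y t]mulrAC hE.
rewrite [(2 * s / _)^-1](_ : _ = s * ((x t + y t) * (x t + z t)) /
    (2 * (x t * y t * z t * (x t + y t + z t)))).
  by field; rewrite !lt0r_neq0.
by rewrite -sE; field; rewrite !lt0r_neq0.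
Qed.

(** The squared inradius is at most x * y, which is at most ((x + y) / 2) ^ 2 by the inequality of
    arithmetic and geometric means. *)
Lemma conductance_le (R : realType) (x y z : R) :
  0 < x -> 0 < y -> 0 < z -> conductance x y z <= 2^-1.
Proof.
move=> x0 y0 z0.
rewrite ler_pdivrMr ?addr_gt0 // -ler_sqr ?nnegrE ?sqrtr_ge0 //; last first.
  by rewrite mulr_ge0 ?invr_ge0 ?addr_ge0 ?ltW.
rewrite sqr_sqrtr; last by rewrite divr_ge0 ?mulr_ge0 ?addr_ge0 ?ltW.
apply: (@le_trans _ _ (x * y)).
  rewrite ler_pdivrMr ?addr_gt0 // ler_pM2l ?mulr_gt0 //.
  by rewrite lerDr addr_ge0 ?ltW.
rewrite -subr_ge0 (_ : _ - _ = (2^-1 * (x - y)) ^+ 2) ?sqr_ge0 //.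
by field.
Qed.

(** Serves to bound the weights from below uniformly along a path of radii that stays in a compact
    interval. *)
Lemma conductance_ge (R : realType) (lo hi x y z : R) :
  0 < lo -> lo <= x <= hi -> lo <= y <= hi -> lo <= z <= hi ->
  Num.sqrt (lo * lo * lo / (hi + hi + hi)) / (hi + hi) <= conductance x y z.
Proof.
move=> lo0 /andP[x1 x2] /andP[y1 y2] /andP[z1 z2].
have x0 := lt_le_trans lo0 x1; have y0 := lt_le_trans lo0 y1.
have z0 := lt_le_trans lo0 z1; have hi0 := lt_le_trans x0 x2.
apply: ler_pM; rewrite ?sqrtr_ge0 ?invr_ge0 ?addr_ge0 ?(ltW hi0) //; last first.
  by rewrite lef_pV2 ?posrE ?addr_gt0 // lerD.
rewrite ler_sqrt; last by rewrite divr_ge0 ?mulr_ge0 ?addr_ge0 ?ltW.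
apply: ler_pM; rewrite ?mulr_ge0 ?invr_ge0 ?addr_ge0 ?(ltW hi0) ?(ltW lo0) //.
  by apply: ler_pM; rewrite ?mulr_ge0 ?(ltW lo0) ?ler_pM ?(ltW lo0).
by rewrite lef_pV2 ?posrE ?addr_gt0 // !lerD.
Qed.

(* Mean value theorem along the path on which the logarithms of the radii are
   affine: there the derivative of the angles is given by symmetric weights. *)
Lemma tangent_angle_variation (R : realType) (x0 y0 z0 x1 y1 z1 : R) :
  0 < x0 -> 0 < y0 -> 0 < z0 -> 0 < x1 -> 0 < y1 -> 0 < z1 ->
  exists2 m : R, 0 < m & forall a b c : R, exists p q s : R,
    [/\ m <= p <= 2^-1, m <= q <= 2^-1, m <= s <= 2^-1 &
     a * (tangent_angle x1 y1 z1 - tangent_angle x0 y0 z0) +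
     b * (tangent_angle y1 z1 x1 - tangent_angle y0 z0 x0) +
     c * (tangent_angle z1 x1 y1 - tangent_angle z0 x0 y0) =
     - (p * (ln (x1 / x0) - ln (y1 / y0)) * (a - b) +
        q * (ln (y1 / y0) - ln (z1 / z0)) * (b - c) +
        s * (ln (z1 / z0) - ln (x1 / x0)) * (c - a))].
Proof.
move=> x00 y00 z00 x10 y10 z10.
pose path u v (t : R) : R := u * expR (t * ln (v / u)).
have path0 u v : path u v 0 = u by rewrite /path mul0r expR0 mulr1.
have path1 u v : 0 < u -> 0 < v -> path u v 1 = v.
  move=> u0 v0; rewrite /path mul1r lnK ?posrE ?divr_gt0 // mulrC divfK //.
  by rewrite gt_eqF.
have path_gt0 (u v t : R) : 0 < u -> 0 < path u v t.
  by move=> u0; rewrite mulr_gt0 ?expR_gt0.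
have Dpath (u v t : R) : is_derive t 1 (path u v) (path u v t * ln (v / u)).
  have D1 : is_derive t 1 (fun s : R => s * ln (v / u)) (ln (v / u)).
    have := is_deriveM (is_derive_id t 1) (is_derive_cst (ln (v / u) : R) t 1).
    by move/is_derive_eq; apply; rewrite scaler0 add0r /GRing.scale /= mulr1.
  have := is_deriveZ u (is_derive1_comp (g := fun s : R => s * ln (v / u))
    (is_derive_expR _) D1).
  by move/is_derive_eq; apply; rewrite /GRing.scale /= mulrA.
have path_bnd (u v t L : R) : `|ln u| + `|ln v| <= L -> 0 < u -> 0 < v -> 0 <= t <= 1 ->
    expR (- L) <= path u v t <= expR L.
  move=> uvL u0 v0 /andP[t0 t1].
  have -> : path u v t = expR ((1 - t) * ln u + t * ln v).
    rewrite /path -{1}[u]lnK ?posrE // ln_div ?posrE // -expRD.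
    by congr expR; ring.
  rewrite !ler_expR -ler_norml; apply: le_trans uvL.
  rewrite (le_trans (ler_normD _ _)) // !normrM (ger0_norm t0).
  by rewrite ger0_norm ?subr_ge0 // lerD // ler_piMl // lerBlDr lerDl.
(* The intermediate point of the mean value theorem will depend on [a], [b], [c]. The radii stay
   between [expR (- L)] and [expR L] on the whole path, so the lower bound for the weights can be
   fixed before these coefficients. *)
pose L := (`|ln x0| + `|ln x1|) + (`|ln y0| + `|ln y1|) + (`|ln z0| + `|ln z1|).
pose hi := expR L; pose lo := expR (- L).
exists (Num.sqrt (lo * lo * lo / (hi + hi + hi)) / (hi + hi)).
  by rewrite divr_gt0 ?sqrtr_gt0 ?divr_gt0 ?mulr_gt0 ?addr_gt0 ?expR_gt0.
move=> a b c.
pose x := path x0 x1; pose y := path y0 y1; pose z := path z0 z1.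
pose w (f g h : R -> R) t := conductance (f t) (g t) (h t).
(* The mean value theorem is applied to the whole combination, so that one [t] serves all three
   angles. *)
pose F t := a * tangent_angle (x t) (y t) (z t) +
  b * tangent_angle (y t) (z t) (x t) + c * tangent_angle (z t) (x t) (y t).
pose X := ln (x1 / x0); pose Y := ln (y1 / y0); pose Z := ln (z1 / z0).
pose dF t := - (w x y z t * (X - Y) * (a - b) + w y z x t * (Y - Z) * (b - c) +
  w z x y t * (Z - X) * (c - a)).
have DF (t : R) : is_derive t 1 F (dF t).
  have Dx := Dpath x0 x1 t; have Dy := Dpath y0 y1 t; have Dz := Dpath z0 z1 t.
  have xt := path_gt0 x0 x1 t x00; have yt := path_gt0 y0 y1 t y00.
  have zt := path_gt0 z0 z1 t z00.
  have := is_deriveD (is_deriveD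
    (is_deriveZ a (is_derive_tangent_angle xt yt zt Dx Dy Dz))
    (is_deriveZ b (is_derive_tangent_angle yt zt xt Dy Dz Dx)))
    (is_deriveZ c (is_derive_tangent_angle zt xt yt Dz Dx Dy)).
  move/is_derive_eq; apply; rewrite /GRing.scale /= /dF /w.
  (* Symmetry merges the six weights of the three derivatives into one per side; this is what
     produces the differences a - b, b - c, c - a. *)
  rewrite (conductanceC (path x0 x1 t) (path z0 z1 t)).
  rewrite (conductanceC (path y0 y1 t) (path x0 x1 t)).
  rewrite (conductanceC (path z0 z1 t) (path y0 y1 t)).
  by rewrite -/x -/y -/z -/X -/Y -/Z; ring.
have [t t01 FE] : exists2 t : R, t \in `]0, 1[%R & F 1 - F 0 = dF t * (1 - 0).
  apply: (MVT ltr01 (fun s _ => DF s)).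
  apply: derivable_within_continuous => s _.
  exact: (@ex_derive _ _ _ _ _ _ _ (DF s)).
have t01' : 0 <= t <= 1.
  by move: t01; rewrite in_itv /= => /andP[? ?]; rewrite !ltW.
have xb : lo <= x t <= hi.
  by apply: path_bnd => //; rewrite /L -addrA lerDl !addr_ge0.
have yb : lo <= y t <= hi.
  by apply: path_bnd => //; rewrite /L addrAC lerDr !addr_ge0.
have zb : lo <= z t <= hi.
  by apply: path_bnd => //; rewrite /L lerDr !addr_ge0.
exists (w x y z t), (w y z x t), (w z x y t); split.
- by rewrite conductance_ge ?expR_gt0 // conductance_le ?path_gt0.
- by rewrite conductance_ge ?expR_gt0 // conductance_le ?path_gt0.
- by rewrite conductance_ge ?expR_gt0 // conductance_le ?path_gt0.
move: FE; rewrite /F /x /y /z !path0 !path1 // subr0 mulr1 /dF => <-.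
by ring.
Qed.

Lemma externally_tangent_sqr (R : realType) (c d : circle R) :
  externally_tangent c d ->
  (complex.Re (Defs.center c) - complex.Re (Defs.center d)) ^+ 2 +
  (complex.Im (Defs.center c) - complex.Im (Defs.center d)) ^+ 2 =
  (Defs.radius c + Defs.radius d) ^+ 2.
Proof.
rewrite /externally_tangent normc_def => /(congr1 (@complex.Re R)) /= <-.
rewrite sqr_sqrtr ?addr_ge0 ?sqr_ge0 //.
by case: (Defs.center c) (Defs.center d) => [? ?] [? ?].
Qed.

Lemma angle_tangent (R : realType) (c1 c2 c3 : circle R) :
  externally_tangent c1 c2 -> externally_tangent c2 c3 ->
  externally_tangent c3 c1 ->
  angle (Defs.center c1) (Defs.center c2) (Defs.center c3) =
  tangent_angle (Defs.radius c1) (Defs.radius c2) (Defs.radius c3).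
Proof.
move=> t12 t23 t31.
have := externally_tangent_sqr t12; have := externally_tangent_sqr t23.
have := externally_tangent_sqr t31.
rewrite /angle /tangent_angle.
rewrite (distrC (Defs.center c2)) t12 t31.
case: c1 c2 c3 {t12 t23 t31} => [[a1 b1] x x0] [[a2 b2] y y0] [[a3 b3] z z0] /=.
move=> e31 e23 e12; congr acos.
have xy0 : 0 < x + y by exact: addr_gt0.
have zx0 : 0 < z + x by exact: addr_gt0.
rewrite mul0r !subr0 mulNr opprK.
(* The scalar product of the two sides, by the law of cosines. *)
rewrite (_ : _ + _ = ((x + y) ^+ 2 + (z + x) ^+ 2 - (y + z) ^+ 2) / 2).
  by field; rewrite (addrC x z) !lt0r_neq0.
by rewrite -e31 -e12 -e23; field.
Qed.

(** * The hitting probabilities of the simple random walk *)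

Definition neighbors (V : choiceType) (adj : V -> V -> Prop) (v : V) :
    {fset V} := fset_set [set u | adj v u].

Lemma in_neighbors (V : choiceType) (adj : V -> V -> Prop) (u v : V) :
  locally_finite adj -> (u \in neighbors adj v) = `[< adj v u >].
Proof.
move=> lf; rewrite /neighbors in_fset_set; last exact: lf.
by apply/idP/asboolP; rewrite inE.
Qed.

Definition walk_mean (R : realType) (V : choiceType) (adj : V -> V -> Prop)
    (f : V -> R) (v : V) : R :=
  \sum_(u <- neighbors adj v) srw_step R adj v u * f u.

(* Probability that the walk started at [v] visits [o] within [k] steps. *)
Fixpoint hit (R : realType) (V : choiceType) (adj : V -> V -> Prop) (o : V)
    (k : nat) (v : V) : R :=
  if v == o then 1
  else if k is k'.+1 then walk_mean adj (hit R adj o k') v else 0.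

Section Hitting.
Variables (R : realType) (V : choiceType) (adj : V -> V -> Prop).
Hypothesis adj_fin : locally_finite adj.
Hypothesis adj_ex : forall v, exists u, adj v u.
Hypothesis adj_sym : forall u v, adj u v -> adj v u.

Local Notation hit := (hit R adj).

Lemma srw_step_ge0 u v : 0 <= srw_step R adj u v.
Proof. by rewrite /srw_step; case: ifP => // _; rewrite invr_ge0. Qed.

Lemma degree_gt0 v : (0 < Defs.degree adj v)%N.
Proof.
have [u vu] := adj_ex v; rewrite /Defs.degree cardfs_gt0.
apply/fset0Pn; exists u.
by rewrite -/(neighbors adj v) in_neighbors //; apply/asboolP.
Qed.

Lemma degree_walk_mean (f : V -> R) v :
  (Defs.degree adj v)%:R * walk_mean adj f v = \sum_(u <- neighbors adj v) f u.
Proof.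
rewrite /walk_mean big_distrr /=; apply: eq_big_seq => u.
rewrite in_neighbors // /srw_step => ->.
by rewrite mulrA divff ?mul1r // pnatr_eq0 -lt0n degree_gt0.
Qed.

Lemma walk_mean_cst (c : R) v : walk_mean adj (fun=> c) v = c.
Proof.
have d0 : (Defs.degree adj v)%:R != 0 :> R by rewrite pnatr_eq0 -lt0n degree_gt0.
apply: (mulfI d0); rewrite degree_walk_mean big_const_seq count_predT.
by rewrite iter_addr_0 mulr_natl.
Qed.

Lemma le_walk_mean (f g : V -> R) v :
  (forall u, f u <= g u) -> walk_mean adj f v <= walk_mean adj g v.
Proof.
by move=> fg; apply: ler_sum => u _; rewrite ler_wpM2l // srw_step_ge0.
Qed.

Lemma hit_refl o k : hit o k o = 1.
Proof. by case: k => [|k] /=; rewrite eqxx. Qed.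

Lemma hitS o k v : v != o -> hit o k.+1 v = walk_mean adj (hit o k) v.
Proof. by rewrite /=; case: eqP. Qed.

Lemma hit_ge0 o k v : 0 <= hit o k v.
Proof.
elim: k v => [|k IH] v /=; case: ifP => // _.
by rewrite -[leLHS](walk_mean_cst 0 v) le_walk_mean.
Qed.

Lemma hit_le1 o k v : hit o k v <= 1.
Proof.
elim: k v => [|k IH] v /=; case: ifP => // _.
by rewrite -[leRHS](walk_mean_cst 1 v) le_walk_mean.
Qed.

(* For [v != o] the right-hand side is the mean of [hit o k] around [v]: the
   function [hit o k] is subharmonic off [o]. *)
Lemma hit_leS o k v : hit o k v <= hit o k.+1 v.
Proof.
elim: k v => [|k IH] v; have [->|vo] := eqVneq v o; rewrite ?hit_refl //.
  by rewrite [leLHS]/= (negPf vo) hit_ge0.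
by rewrite !hitS // le_walk_mean.
Qed.

Lemma hit_finite_support o k : finite_set [set v | hit o k v != 0].
Proof.
elim: k => [|k IH].
  apply: sub_finite_set (finite_set1 o) => v /=.
  by have [->|_] := eqVneq v o; rewrite ?eqxx.
have fin : finite_set ([set o] `|`
    \bigcup_(u in [set v | hit o k v != 0]) [set w | adj u w]).
  by rewrite finite_setU; split; [exact: finite_set1|exact: bigcup_finite].
apply: sub_finite_set fin => v; have [->|vo] := eqVneq v o; first by left.
move=> hv; right; apply: contrapT => nv; move: hv => /=; rewrite (negPf vo).
apply/negP; rewrite negbK /walk_mean big1_seq // => u /andP[_].
rewrite in_neighbors // => /asboolP vu.
suff /eqP -> : hit o k u == 0 by rewrite mulr0.
by apply: contra_notT nv => hu; exists u => //=; exact: adj_sym.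
Qed.

(** A non-zero hitting probability yields a path from [v] to [o]. Connectedness of the graph is used
    in this form: a property of [o] that passes to neighbors holds at [v]. *)
Lemma hit_connected o k v (A : set V) :
  hit o k v != 0 -> A o -> (forall u w, adj u w -> A w -> A u) -> A v.
Proof.
move=> + Ao Aadj; elim: k v => [|k IH] v; have [->//|vo] := eqVneq v o.
  by rewrite /= (negPf vo) eqxx.
rewrite hitS //; apply: contra_neqP => nAv.
rewrite /walk_mean big1_seq // => u /andP[_].
rewrite in_neighbors // => /asboolP vu.
suff /eqP -> : hit o k u == 0 by rewrite mulr0.
by apply: contra_notT nAv => /IH; exact: Aadj.
Qed.

(** Discrete Green formula: exchanging [u] and [v] in the sum on the right and adding the two
    versions completes the square. Both indices range over the same [s], so no boundary term
    appears. *)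
Lemma dirichlet_sum (g : V -> R) (s : seq V) :
  \sum_(v <- s) \sum_(u <- s | `[< adj v u >]) (g v - g u) ^+ 2 =
  2 * \sum_(v <- s) g v * \sum_(u <- s | `[< adj v u >]) (g v - g u).
Proof.
have -> : \sum_(v <- s) g v * \sum_(u <- s | `[< adj v u >]) (g v - g u) =
    \sum_(v <- s) \sum_(u <- s | `[< adj v u >]) g v * (g v - g u).
  by apply: eq_bigr => v _; rewrite big_distrr.
rewrite mulr_natl mulr2n; set S := (X in _ = X + X).
have SE : S = \sum_(v <- s) \sum_(u <- s | `[< adj v u >]) g u * (g u - g v).
  rewrite /S; under eq_bigr do rewrite big_mkcond.
  rewrite exchange_big /=; apply: eq_bigr => v _.
  rewrite [RHS]big_mkcond; apply: eq_bigr => u _.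
  rewrite (_ : `[< adj u v >] = `[< adj v u >]) //.
  by apply/asboolP/asboolP; exact: adj_sym.
rewrite {2}SE /S -big_split; apply: eq_bigr => v _ /=.
by rewrite -big_split; apply: eq_bigr => u _ /=; ring.
Qed.

(** After the Green formula, the term at [v] is [g v] times the degree times the excess of [g v]
    over its mean. It vanishes off the support, is at most 0 at the other vertices than [o] by
    subharmonicity, and at [o] it is the bound. [B] contains the neighbors of the support, so that
    the means are complete. *)
Lemma hit_energy o k (B : {fset V}) :
  (forall v, hit o k v != 0 -> v \in B /\ {subset neighbors adj v <= B}) ->
  \sum_(v <- B) \sum_(u <- B | `[< adj v u >]) (hit o k v - hit o k u) ^+ 2 <=
  2 * ((Defs.degree adj o)%:R * (1 - walk_mean adj (hit o k) o)).
Proof.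
set g := hit o k => supp; rewrite dirichlet_sum ler_pM2l //.
set C := _%:R * _.
have oB : o \in B by have [] := supp o; rewrite ?/g ?hit_refl ?oner_eq0.
have -> : C = \sum_(v <- B) if v == o then C else 0.
  rewrite (bigD1_seq o oB (fset_uniq B)) eqxx /= big1 ?addr0 // => v.
  by move/negPf => ->.
apply: ler_sum => v _.
have [gv0|gv0] := eqVneq (g v) 0.
  rewrite gv0 mul0r /=; case: eqP => // vo.
  by move: gv0; rewrite vo /g hit_refl => /eqP; rewrite oner_eq0.
have [vB nB] := supp v gv0.
have -> : \sum_(u <- B | `[< adj v u >]) (g v - g u) =
    (Defs.degree adj v)%:R * (g v - walk_mean adj g v).
  rewrite mulrBr degree_walk_mean.
  have -> : (Defs.degree adj v)%:R * g v = \sum_(u <- neighbors adj v) g v.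
    by rewrite big_const_seq count_predT iter_addr_0 mulr_natl.
  rewrite -big_filter.
  have pe : perm_eq [seq u <- B | `[< adj v u >]] (neighbors adj v).
    apply: uniq_perm; rewrite ?filter_uniq ?fset_uniq // => u.
    rewrite mem_filter in_neighbors //; case: asboolP => //= vu.
    by apply: nB; rewrite in_neighbors //; apply/asboolP.
  by rewrite (perm_big _ pe) -sumrB.
have [->|vo] := eqVneq v o.
  by rewrite /g hit_refl mul1r.
rewrite mulr_ge0_le0 ?hit_ge0 // mulr_ge0_le0 // subr_le0.
by rewrite -hitS // hit_leS.
Qed.

End Hitting.

(** * Recurrence makes the hitting probabilities tend to 1 *)

Section Escape.
Variables (R : realType) (V : choiceType) (adj : V -> V -> Prop).
Hypothesis adj_fin : locally_finite adj.
Hypothesis adj_ex : forall v, exists u, adj v u.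

Local Notation hit := (hit R adj).

Definition avoid_event (T : Type) (X : nat -> T -> V) (o : V) (x : nat -> V)
    (n k : nat) : set T :=
  [set t | forall i, (i <= n)%N -> X i t = x i] `&`
  [set t | forall i, (n <= i <= n + k)%N -> X i t <> o].

Lemma measurable_avoid_event (d : measure_display) (T : measurableType d)
    (X : nat -> T -> V) (o : V) (x : nat -> V) (n k : nat) :
  (forall m u, measurable (X m @^-1` [set u])) ->
  measurable (avoid_event X o x n k).
Proof.
move=> mX; apply: measurableI.
  rewrite (_ : [set _ | _] = \bigcap_(i in [set i | (i <= n)%N])
    (X i @^-1` [set x i])) //.
  by apply: bigcap_measurableType => i _; exact: mX.
rewrite (_ : [set _ | _] = \bigcap_(i in [set i | (n <= i <= n + k)%N])
  ~` (X i @^-1` [set o])) //.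
by apply: bigcap_measurableType => i _; apply: measurableC; exact: mX.
Qed.

(** The Markov property enters only through path probabilities: the induction on [k] lengthens the
    prescribed path by one step, for every [n] and [x] at once. Only moves to neighbors of [x n] are
    kept, whence an inequality. *)
Lemma escape_le_avoid (v o : V) (d : measure_display) (T : measurableType d)
    (P : probability T R) (X : nat -> T -> V) (x : nat -> V) (n k : nat) :
  simple_random_walk adj v P X ->
  ((((x 0%N == v)%:R * \prod_(i < n) srw_step R adj (x i) (x i.+1)) *
    (1 - hit o k (x n)))%:E <= P (avoid_event X o x n k))%E.
Proof.
move=> [mX PX].
have mE (y : nat -> V) m j := measurable_avoid_event o y m j mX.
elim: k n x => [|k IH] n x; have [xo|xo] := eqVneq (x n) o.
- by rewrite xo hit_refl // subrr mulr0 measure_ge0.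
- rewrite /= (negPf xo) subr0 mulr1 -PX le_eqVlt; apply/orP; left; apply/eqP.
  congr (P _); apply/seteqP; split=> t /=; last by case.
  move=> Xx; split=> // i; rewrite addn0 -eqn_leq => /eqP <-.
  by rewrite Xx //; exact/eqP.
- by rewrite xo hit_refl // subrr mulr0 measure_ge0.
(* [ext w] is read only up to time n + 1, where its value is [w]; hence the events [F w] are
   pairwise disjoint. *)
pose ext w i := if (i <= n)%N then x i else w.
have extn w : ext w n.+1 = w by rewrite /ext ltnn.
have extx w i : (i <= n)%N -> ext w i = x i by rewrite /ext => ->.
pose F w := avoid_event X o (ext w) n.+1 k.
have FF : \bigcup_(w in [set w | adj (x n) w]) F w `<=` avoid_event X o x n k.+1.
  move=> t [w _ [tx to]]; split=> i /= => [i_n|].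
    by rewrite tx ?extx // ltnW.
  rewrite leq_eqVlt => /andP[/orP[/eqP <- _|ni ik]].
    by rewrite tx // extx //; exact/eqP.
  by apply: to; rewrite ni addSnnS.
apply: (@le_trans _ _ (P (\bigcup_(w in [set w | adj (x n) w]) F w))); last first.
  apply: le_measure => //; rewrite inE //.
  apply: fin_bigcup_measurable => //.
  by move=> w _; exact: mE.
rewrite measure_fin_bigcup; last first.
- by move=> w _; exact: mE.
- move=> w w' _ _ [t [[tw _] [tw' _]]].
  by rewrite -(extn w) -(extn w') -tw // -tw'.
- exact: adj_fin.
rewrite fsbig_finite /=; last exact: adj_fin.

(* Writing 1 as the mean of the constant 1 turns the escape probability at [x n] into the mean of
   those at its neighbors with one step less. *)
rewrite (negPf xo) -[X in (X - _)](walk_mean_cst adj_fin adj_ex 1 (x n)).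
rewrite -/(neighbors adj (x n)) /walk_mean -sumrB big_distrr /= -sumEFin.
apply: lee_sum => w _; apply: le_trans (IH n.+1 (ext w)).
rewrite lee_fin big_ord_recr /= extn (extx w n) // (extx w 0%N) //.
have -> : \prod_(i < n) srw_step R adj (ext w i) (ext w i.+1) =
    \prod_(i < n) srw_step R adj (x i) (x i.+1).
  by apply: eq_bigr => i _; rewrite !extx // ltnW.
by rewrite le_eqVlt; apply/orP; left; apply/eqP; ring.
Qed.

(** The events of avoiding [o] up to time [k] decrease to that of never visiting [o], which is null
    by recurrence. So [hit o k v] is squeezed between 1 minus their probability and 1. *)
Lemma recurrent_hit (o v : V) :
  recurrent R adj -> hit o k v @[k --> \oo] --> (1 : R).
Proof.
move=> /(_ v)[d [T [P [X [srw [N [mN N0 XN]]]]]]].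
pose F k := avoid_event X o (fun=> v) 0 k.
have mF k : measurable (F k) by apply: measurable_avoid_event; case: srw.
have F0 : P (\bigcap_k F k) = 0%E.
  apply: (subset_measure0 _ mN _ N0); first exact: bigcapT_measurable.
  move=> t Ft; apply: XN => /(_ o 0%N)[n _ Xn].
  by have [_ /(_ n)] := Ft n I; apply => //=.
have Fcvg : (P \o F) k @[k --> \oo] --> (0 : \bar R).
  rewrite -F0; apply: nonincreasing_cvg_mu => //.
  - by rewrite (le_lt_trans (probability_le1 _ _)) // ltry.
  - exact: bigcapT_measurable.
  move=> i j ij; apply/subsetPset => t [tx to]; split=> // m /= mi.
  by apply: to; rewrite (leq_trans mi) // leq_add2l.
have {Fcvg} Fcvg : fine (P (F k)) @[k --> \oo] --> (0 : R) by exact: fine_cvg Fcvg.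
have lo : 1 - fine (P (F k)) @[k --> \oo] --> (1 : R).
  by rewrite -[X in _ --> X](subr0 1); apply: cvgB => //; exact: cvg_cst.
apply: (squeeze_cvgr _ lo (cvg_cst (1 : R))); near=> k.
rewrite hit_le1 // andbT lerBlDr -lerBlDl -lee_fin fineK ?fin_num_measure //.
have := escape_le_avoid o (fun=> v) 0 k srw.
by rewrite big_ord0 eqxx mulr1 mul1r.
Unshelve. all: end_near. Qed.

End Escape.

(** * Picone's identity on a face *)

Lemma picone (R : realFieldType) (h1 h2 g1 g2 : R) : h1 != 0 -> h2 != 0 ->
  (h1 - h2) * (g1 ^+ 2 / h1 - g2 ^+ 2 / h2) =
  (g1 - g2) ^+ 2 - h1 * h2 * (g1 / h1 - g2 / h2) ^+ 2.
Proof. by move=> h10 h20; field; rewrite h10 h20. Qed.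

(** The mean value formula is tested with the squares divided by C minus the log ratios, and
    Picone's identity is applied on each side. The upper bound 1/2 on the weights gives the energy,
    the lower bound keeps a remainder on the first side. [m] precedes [f], [g], [h] so that it
    survives a limit of test functions. *)
Lemma triangle_picone (R : realType) (x0 y0 z0 x1 y1 z1 C : R) :
  0 < x0 -> 0 < y0 -> 0 < z0 -> 0 < x1 -> 0 < y1 -> 0 < z1 ->
  ln (x1 / x0) < C -> ln (y1 / y0) < C -> ln (z1 / z0) < C ->
  exists2 m : R, 0 < m & forall f g h : R,
    f ^+ 2 / (C - ln (x1 / x0)) *
      (tangent_angle x1 y1 z1 - tangent_angle x0 y0 z0) +
    g ^+ 2 / (C - ln (y1 / y0)) *
      (tangent_angle y1 z1 x1 - tangent_angle y0 z0 x0) +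
    h ^+ 2 / (C - ln (z1 / z0)) *
      (tangent_angle z1 x1 y1 - tangent_angle z0 x0 y0) +
    m * (f / (C - ln (x1 / x0)) - g / (C - ln (y1 / y0))) ^+ 2 <=
    2^-1 * ((f - g) ^+ 2 + (g - h) ^+ 2 + (h - f) ^+ 2).
Proof.
move=> x00 y00 z00 x10 y10 z10.
have [m m0 mP] := tangent_angle_variation x00 y00 z00 x10 y10 z10.
move: mP; set X := ln (x1 / x0); set Y := ln (y1 / y0); set Z := ln (z1 / z0).
move=> mP XC YC ZC.
have X0 : 0 < C - X by rewrite subr_gt0.
have Y0 : 0 < C - Y by rewrite subr_gt0.
have Z0 : 0 < C - Z by rewrite subr_gt0.
exists (m * ((C - X) * (C - Y))); first by rewrite !mulr_gt0.
move=> f g h.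
have [p [q [s [/andP[mp p2] /andP[mq q2] /andP[ms s2] ->]]]] :=
  mP (f ^+ 2 / (C - X)) (g ^+ 2 / (C - Y)) (h ^+ 2 / (C - Z)).
have edge_le (A B w a b : R) : A < C -> B < C -> m <= w -> w <= 2^-1 ->
    - (w * (A - B) * (a ^+ 2 / (C - A) - b ^+ 2 / (C - B))) +
    m * ((C - A) * (C - B)) * (a / (C - A) - b / (C - B)) ^+ 2 <=
    2^-1 * (a - b) ^+ 2.
  move=> AC BC mw w2.
  have A0 : C - A != 0 by rewrite subr_eq0 gt_eqF.
  have B0 : C - B != 0 by rewrite subr_eq0 gt_eqF.
  have -> : - (w * (A - B) * (a ^+ 2 / (C - A) - b ^+ 2 / (C - B))) =
      w * (((C - A) - (C - B)) * (a ^+ 2 / (C - A) - b ^+ 2 / (C - B))) by ring.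
  rewrite picone // mulrBr -addrA -[leRHS]addr0 lerD //.
    by rewrite ler_wpM2r ?sqr_ge0.
  set H := (C - A) * (C - B); set D := _ ^+ 2.
  have -> : - (w * (H * D)) + m * H * D = - ((w - m) * (H * D)) by ring.
  have H0 : 0 <= H by rewrite mulr_ge0 // subr_ge0 ltW.
  have D0 : 0 <= D by exact: sqr_ge0.
  by rewrite oppr_le0; apply: mulr_ge0; [rewrite subr_ge0|exact: mulr_ge0].
have e1 := edge_le X Y p f g XC YC mp p2.
have e2 := edge_le Y Z q g h YC ZC mq q2.
have e3 := edge_le Z X s h f ZC XC ms s2.
(* The remainders on the two other sides are dropped. *)
have n2 : 0 <= m * ((C - Y) * (C - Z)) * (g / (C - Y) - h / (C - Z)) ^+ 2.
  by apply: mulr_ge0; [rewrite !mulr_ge0 ?ltW|exact: sqr_ge0].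
have n3 : 0 <= m * ((C - Z) * (C - X)) * (h / (C - Z) - f / (C - X)) ^+ 2.
  by apply: mulr_ge0; [rewrite !mulr_ge0 ?ltW|exact: sqr_ge0].
move: e1 e2 e3 n2 n3.
set E1 := p * _ * _; set E2 := q * _ * _; set E3 := s * _ * _.
set N1 := m * _ * _; set N2 := m * _ * _; set N3 := m * _ * _.
set D1 := _ ^+ 2; set D2 := _ ^+ 2; set D3 := _ ^+ 2.
lra.
Qed.

(** * Sums over the faces *)

(* A face is counted once for each of its three positive orderings. *)
Section Complex.
Variables (V : choiceType) (K : oriented_complex V).

Lemma edge_sym u v : edge K u v -> edge K v u.
Proof. by move=> [w [|] f]; exists w; [right|left]. Qed.

Lemma edge_exists u : exists v, edge K u v.
Proof. by have [v [w f]] := face_cover K u; exists v, w; left. Qed.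

Lemma face_edge u v w : K u v w -> edge K u v.
Proof. by move=> f; exists w; left. Qed.

Lemma face_sum_rot (R : nmodType) (s : seq V) (F : V -> V -> V -> R) :
  \sum_(u <- s) \sum_(v <- s) \sum_(w <- s | `[< K u v w >]) F v w u =
  \sum_(u <- s) \sum_(v <- s) \sum_(w <- s | `[< K u v w >]) F u v w.
Proof.
have rot u v w : `[< K u v w >] = `[< K v w u >].
  by apply/asboolP/asboolP => [|/face_rot]; exact: face_rot.
transitivity (\sum_(u <- s) \sum_(v <- s) \sum_(w <- s)
    if `[< K v w u >] then F v w u else 0).
  apply: eq_bigr => u _; apply: eq_bigr => v _.
  by rewrite big_mkcond; apply: eq_bigr => w _; rewrite rot.
rewrite exchange_big; apply: eq_bigr => v _ /=.
rewrite exchange_big; apply: eq_bigr => w _ /=.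
by rewrite [RHS]big_mkcond.
Qed.

Lemma face_sum_ge (R : numDomainType) (B : {fset V}) (F : V -> V -> V -> R)
    (x y z : V) :
  (forall u v w, K u v w -> 0 <= F u v w) ->
  x \in B -> y \in B -> z \in B -> K x y z ->
  F x y z <= \sum_(u <- B) \sum_(v <- B) \sum_(w <- B | `[< K u v w >]) F u v w.
Proof.
move=> F0 xB yB zB xyz.
have le1 (G : V -> R) t : t \in B -> (forall u, 0 <= G u) ->
    G t <= \sum_(u <- B) G u.
  by move=> tB G0; rewrite (bigD1_seq t) ?fset_uniq //= lerDl sumr_ge0.
have F0' u v w : 0 <= if `[< K u v w >] then F u v w else 0.
  by case: asboolP => // /F0.
apply: le_trans (le1 (fun u => _) x xB _) => [|u]; last first.
  by apply: sumr_ge0 => v _; rewrite big_mkcond sumr_ge0.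
apply: le_trans (le1 (fun u => _) y yB _) => [|u]; last first.
  by rewrite big_mkcond sumr_ge0.
rewrite big_mkcond; apply: le_trans (le1 (fun u => _) z zB _) => //.
by rewrite asboolT.
Qed.

(** An oriented edge begins exactly one positively oriented face, so the sum over [w] has at most
    one term, and none if the third vertex lies outside [B]. *)
Lemma face_sum_edge (R : numDomainType) (B : {fset V}) (F : V -> V -> R) :
  no_boundary K -> (forall u v, 0 <= F u v) ->
  \sum_(u <- B) \sum_(v <- B) \sum_(w <- B | `[< K u v w >]) F u v <=
  \sum_(u <- B) \sum_(v <- B | `[< edge K u v >]) F u v.
Proof.
move=> nb F0; apply: ler_sum => u _; rewrite [leRHS]big_mkcond.
apply: ler_sum => v _; case: asboolP => [/nb[w [uvw uniq_w]]|nuv]; last first.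
  rewrite big1 // => w /asboolP /face_edge //.
have [wB|wB] := boolP (w \in B); last first.
  rewrite big1_seq // => t /andP[/asboolP /uniq_w <-].
  by move=> /(negP wB).
rewrite big_mkcond (bigD1_seq w) ?fset_uniq //= asboolT // big1 ?addr0 // => t tw.
by case: asboolP => // /uniq_w wt; move: tw; rewrite wt eqxx.
Qed.

Lemma angle_sum_fset (R : realType) (P : V -> circle R) (B : {fset V}) v :
  locally_finite (edge K) -> {subset neighbors (edge K) v <= B} ->
  angle_sum K P v = \sum_(u <- B) \sum_(w <- B | `[< K v u w >])
    angle (Defs.center (P v)) (Defs.center (P u)) (Defs.center (P w)).
Proof.
move=> lf nB; rewrite /angle_sum.
pose r := [seq p <- [seq (u, w) | u <- B, w <- B] | `[< K v p.1 p.2 >]].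
rewrite (fsbig_fwiden r); last first.
- move=> -[u w] [/=]; rewrite mem_filter /= => /andP[/asboolP vuw _].
  by move=> /(_ vuw).
- by rewrite filter_uniq // allpairs_uniq ?fset_uniq // => -[? ?] [].
- move=> -[u w] /= vuw; rewrite mem_filter /= asboolT //=.
  apply/allpairsP; exists (u, w); split=> //=; apply: nB.
    by rewrite in_neighbors //; apply/asboolP; exact: face_edge vuw.
  rewrite in_neighbors //; apply/asboolP/edge_sym.
  exact: face_edge (face_rot (face_rot vuw)).
rewrite /r big_filter big_mkcond big_allpairs /=.
by apply: eq_bigr => u _; rewrite [RHS]big_mkcond.
Qed.

End Complex.

(** * The Liouville property *)

Definition log_ratio (R : realType) (V : choiceType) (P Q : V -> circle R)
    (v : V) : R :=
  ln (Defs.radius (Q v) / Defs.radius (P v)).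

Section Liouville.
Variables (R : realType) (V : choiceType) (K : oriented_complex V).
Variables (P Q : V -> circle R).
Hypothesis K_fin : locally_finite (edge K).
Hypothesis K_closed : no_boundary K.
Hypothesis K_rec : recurrent R (edge K).
Hypothesis packP : circle_packing K P.
Hypothesis packQ : circle_packing K Q.
Hypothesis same_angles : forall v, angle_sum K P v = angle_sum K Q v.

Let phi := log_ratio P Q.
Let dtheta u v w : R :=
  tangent_angle (Defs.radius (Q u)) (Defs.radius (Q v)) (Defs.radius (Q w)) -
  tangent_angle (Defs.radius (P u)) (Defs.radius (P v)) (Defs.radius (P w)).

(* Summation by faces of [\sum_u a u * (Theta_Q u - Theta_P u) = 0]. *)
Lemma weighted_angle_variation (B : {fset V}) (a : V -> R) :
  (forall v, a v != 0 -> {subset neighbors (edge K) v <= B}) ->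
  \sum_(u <- B) \sum_(v <- B) \sum_(w <- B | `[< K u v w >])
    (a u * dtheta u v w + a v * dtheta v w u + a w * dtheta w u v) = 0.
Proof.
move=> supp.
have S0 : \sum_(u <- B) \sum_(v <- B) \sum_(w <- B | `[< K u v w >])
    a u * dtheta u v w = 0.
  rewrite big1 // => u _; have [->|au] := eqVneq (a u) 0.
    by rewrite big1 // => v _; rewrite big1 // => w _; rewrite mul0r.
  under eq_bigr do rewrite -big_distrr /=.
  rewrite -big_distrr /=; apply/eqP; rewrite mulf_eq0; apply/orP; right.
  apply/eqP; transitivity (angle_sum K Q u - angle_sum K P u).
    rewrite !(angle_sum_fset _ K_fin (supp _ au)) -sumrB.
    apply: eq_bigr => v _; rewrite -sumrB; apply: eq_bigr => w /asboolP uvw.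
    have [pt1 pt2 pt3 _] := packP uvw; have [qt1 qt2 qt3 _] := packQ uvw.
    by rewrite !angle_tangent.
  by rewrite same_angles subrr.
have S1 := face_sum_rot K B (fun u v w => a u * dtheta u v w).
have S2 := face_sum_rot K B (fun u v w => a v * dtheta v w u).
rewrite S0 in S1; rewrite S1 in S2.
transitivity (\sum_(u <- B) \sum_(v <- B) \sum_(w <- B | `[< K u v w >])
      a u * dtheta u v w +
   (\sum_(u <- B) \sum_(v <- B) \sum_(w <- B | `[< K u v w >])
      a v * dtheta v w u +
    \sum_(u <- B) \sum_(v <- B) \sum_(w <- B | `[< K u v w >])
      a w * dtheta w u v)).
  rewrite -!big_split; apply: eq_bigr => u _ /=.
  rewrite -!big_split; apply: eq_bigr => v _ /=.
  by rewrite -!big_split; apply: eq_bigr => w _ /=; rewrite addrA.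
by rewrite S0 S1 S2 !addr0.
Qed.

Variable C : R.
Hypothesis phi_lt : forall v, phi v < C.

Lemma face_picone x y z : K x y z ->
  exists2 m : R, 0 < m & forall g : V -> R,
    g x ^+ 2 / (C - phi x) * dtheta x y z +
    g y ^+ 2 / (C - phi y) * dtheta y z x +
    g z ^+ 2 / (C - phi z) * dtheta z x y +
    m * (g x / (C - phi x) - g y / (C - phi y)) ^+ 2 <=
    2^-1 * ((g x - g y) ^+ 2 + (g y - g z) ^+ 2 + (g z - g x) ^+ 2).
Proof.
move=> xyz.
have [m m0 mP] := triangle_picone (radius_gt0 (P x)) (radius_gt0 (P y))
  (radius_gt0 (P z)) (radius_gt0 (Q x)) (radius_gt0 (Q y)) (radius_gt0 (Q z))
  (phi_lt x) (phi_lt y) (phi_lt z).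
by exists m => // g; exact: mP.
Qed.

(** Tested with [hit x k], the Picone remainder on the edge xy is bounded by an energy that tends to
    0. In the limit the test function is 1 at both ends, so C - phi takes the same value there. *)
Lemma log_ratio_face x y z : K x y z -> phi x = phi y.
Proof.
move=> xyz; have [m m0 mP] := face_picone xyz.
(* The 3 is 1/2 from the weights, times 3 because the face sum of [E] meets each side three times,
   times 2 from [hit_energy]. *)
have bound k :
    m * (hit R (edge K) x k x / (C - phi x) -
         hit R (edge K) x k y / (C - phi y)) ^+ 2 <=
    3 * ((Defs.degree (edge K) x)%:R *
      (1 - walk_mean (edge K) (hit R (edge K) x k) x)).
  set g := hit R (edge K) x k.
  pose S := [set v | g v != 0].
  have Sfin : finite_set S.
    by apply: hit_finite_support => //; exact: edge_sym.
  pose A := S `|` \bigcup_(v in S) [set u | edge K v u] `|` [set x; y; z].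
  have Afin : finite_set A.
    rewrite !finite_setU; split; first split=> //.
      by apply: bigcup_finite => // v _; exact: K_fin.
    by split; [split|]; exact: finite_set1.
  pose B := fset_set A.
  have inB v : A v -> v \in B by move=> Av; rewrite in_fset_set // inE.
  have supp v : g v != 0 -> v \in B /\ {subset neighbors (edge K) v <= B}.
    move=> gv; split; first by apply: inB; left; left.
    move=> u; rewrite in_neighbors // => /asboolP vu.
    by apply: inB; left; right; exists v.
  have energy := hit_energy K_fin (edge_exists K) (@edge_sym _ K) supp.
  pose a v := g v ^+ 2 / (C - phi v).
  pose E u v w := 2^-1 * ((g u - g v) ^+ 2 + (g v - g w) ^+ 2 + (g w - g u) ^+ 2).
  (* [F] is the Picone defect of a face. It is non-negative, has the same total as [E] since the
     angle variations cancel, and on the face xyz dominates the remainder to be bounded. *)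
  pose F u v w := E u v w -
    (a u * dtheta u v w + a v * dtheta v w u + a w * dtheta w u v).
  have F0 u v w : K u v w -> 0 <= F u v w.
    move=> /face_picone[m' m'0 m'P].
    rewrite subr_ge0; apply: le_trans (m'P g); rewrite lerDl.
    by rewrite mulr_ge0 ?sqr_ge0 // ltW.
  have xB : x \in B by apply: inB; right; left; left.
  have yB : y \in B by apply: inB; right; left; right.
  have zB : z \in B by apply: inB; right; right.
  apply: le_trans (_ : F x y z <= _).
    by rewrite /F lerBrDl; exact: mP.
  apply: le_trans (face_sum_ge F0 xB yB zB xyz) _.
  have suppa v : a v != 0 -> {subset neighbors (edge K) v <= B}.
    move=> av; apply: (supp v _).2; apply: contra_neq av => gv.
    by rewrite /a gv expr0n mul0r.
  have -> : \sum_(u <- B) \sum_(v <- B) \sum_(w <- B | `[< K u v w >]) F u v w =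
      \sum_(u <- B) \sum_(v <- B) \sum_(w <- B | `[< K u v w >]) E u v w.
    have W := weighted_angle_variation suppa.
    rewrite -[RHS]subr0 -[X in _ = _ - X]W. rewrite -sumrB.
    apply: eq_bigr => u _; rewrite -sumrB; apply: eq_bigr => v _.
    by rewrite -sumrB.
  (* The dummy third argument lets [face_sum_rot] identify the sums of the three squares in [E]. *)
  pose D u v (w : V) := (g u - g v) ^+ 2.
  have -> : \sum_(u <- B) \sum_(v <- B) \sum_(w <- B | `[< K u v w >]) E u v w =
      2^-1 * (3 * \sum_(u <- B) \sum_(v <- B) \sum_(w <- B | `[< K u v w >])
        D u v w).
    have S1 := face_sum_rot K B D.
    have S2 := face_sum_rot K B (fun u v w => D v w u).
    rewrite S1 in S2; rewrite (_ : 3 = 1 + 1 + 1 :> R); last by ring.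
    rewrite !mulrDl !mul1r -{2}S1 -{2}S2 -!big_split big_distrr.
    apply: eq_bigr => u _ /=; rewrite -!big_split big_distrr.
    apply: eq_bigr => v _ /=; rewrite -!big_split big_distrr.
    by apply: eq_bigr => w _.
  have le_edge := face_sum_edge B K_closed (fun u v => sqr_ge0 (g u - g v)).
  have := le_trans le_edge energy.
  rewrite -/g; set T := \sum_(u <- B) _; set T' := _ * (1 - _).
  lra.
have hit1 v : hit R (edge K) x k v @[k --> \oo] --> (1 : R).
  by apply: recurrent_hit => //; exact: edge_exists.
have lim_lhs : m * (hit R (edge K) x k x / (C - phi x) -
    hit R (edge K) x k y / (C - phi y)) ^+ 2 @[k --> \oo] -->
    m * (1 / (C - phi x) - 1 / (C - phi y)) ^+ 2.
  have lim_diff : hit R (edge K) x k x / (C - phi x) -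
      hit R (edge K) x k y / (C - phi y) @[k --> \oo] -->
      1 / (C - phi x) - 1 / (C - phi y).
    by apply: cvgB; apply: cvgM => //; exact: cvg_cst.
  exact: (cvgM (cvg_cst m) (cvgM lim_diff lim_diff)).
have lim_mean : walk_mean (edge K) (hit R (edge K) x k) x @[k --> \oo] --> (1 : R).
  rewrite -[X in _ --> X](walk_mean_cst K_fin (edge_exists K) 1 x).
  apply: cvg_big => [|u _]; first exact: add_continuous.
  by apply: cvgM => //; exact: cvg_cst.
have lim_rhs : 3 * ((Defs.degree (edge K) x)%:R *
    (1 - walk_mean (edge K) (hit R (edge K) x k) x)) @[k --> \oo] --> (0 : R).
  have -> : (0 : R) = 3 * ((Defs.degree (edge K) x)%:R * (1 - 1)).
    by rewrite subrr !mulr0.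
  apply: cvgM; first exact: cvg_cst.
  apply: cvgM; first exact: cvg_cst.
  by apply: cvgB => //; exact: cvg_cst.
have := ler_cvg_to lim_lhs lim_rhs (nearW _ bound).
rewrite pmulr_rle0 // => le0.
have /eqP : (1 / (C - phi x) - 1 / (C - phi y)) ^+ 2 = 0.
  by apply/eqP; rewrite eq_le le0 sqr_ge0.
rewrite sqrf_eq0 subr_eq0 !div1r => /eqP /invr_inj /eqP.
by rewrite -subr_eq0 opprB addrC addrA subrK subr_eq0 => /eqP ->.
Qed.

(** By recurrence some [hit v k u] is non-zero, which joins [u] to [v]; equality then spreads along
    edges. *)
Lemma log_ratio_constant u v : phi u = phi v.
Proof.
have hit1 := recurrent_hit K_fin (edge_exists K) v u K_rec.
have [k hk] : exists k, hit R (edge K) v k u != 0.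
  apply: contrapT => no; suff : (0 : R) = 1 by move/eqP; rewrite eq_sym oner_eq0.
  apply: cvg_unique hit1 => //.
  rewrite (_ : (fun k => _) = fun=> 0); first exact: cvg_cst.
  apply/funext => k; apply: contrapT => /eqP hk; apply: no; exists k; exact: hk.
apply: (hit_connected K_fin (A := [set w | phi w = phi v]) hk) => //.
by move=> s t [w [|] f] /= <-; [|symmetry]; exact: log_ratio_face f.
Qed.

End Liouville.

(** * From log ratios at vertices to ratio maps on carriers *)

Lemma realization_sum (R : realType) (V : choiceType) (K : oriented_complex V)
    (x : {ptws V -> R}) (f : V -> R) (u v w : V) :
  K u v w -> (forall s, s <> u -> s <> v -> s <> w -> x s = 0) ->
  \sum_(s \in [set: V]) x s * f s = x u * f u + x v * f v + x w * f w.
Proof.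
move=> uvw x0.
have uv := face_neq uvw; have vw := face_neq (face_rot uvw).
have wu := face_neq (face_rot (face_rot uvw)).
have uniq_uvw : uniq [:: u; v; w].
  rewrite /= !inE negb_or andbT; apply/andP; split; last exact/eqP.
  by apply/andP; split; apply/eqP => // uw; apply: wu.
rewrite -(fsbig_widen [set` [:: u; v; w]]) //; last first.
  move=> s [_ /= /negP]; rewrite !inE !negb_or.
  by case/and3P => /eqP su /eqP sv /eqP sw; rewrite x0 // mul0r.
by rewrite -fsbig_seq // !big_cons big_nil /= addr0 addrA.
Qed.

Lemma ratio_map_vertex (R : realType) (V : choiceType) (K : oriented_complex V)
    (P Q : V -> circle R) (v : V) :
  exists2 p, carrier K P p & ratio_map P Q p = Defs.radius (Q v) / Defs.radius (P v).
Proof.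
have [b [c vbc]] := face_cover K v.
have x0 s : s <> v -> vertex_pt R v s = 0.
  by rewrite /vertex_pt => /eqP/negPf ->.
have xv : vertex_pt R v v = 1 by rewrite /vertex_pt eqxx.
have bv : b <> v by move=> bv; apply: (face_neq vbc).
have cv : c <> v by exact: face_neq (face_rot (face_rot vbc)).
exists (vertex_pt R v, S_map P (vertex_pt R v)).
  split=> //=; split=> [s|]; first by rewrite /vertex_pt.
  exists v, b, c; split=> // [|s sv _ _]; last exact: x0.
  by rewrite xv (x0 b bv) (x0 c cv) !addr0.
rewrite /ratio_map /= (realization_sum _ vbc) => [|s sv _ _]; last exact: x0.
by rewrite xv (x0 b bv) (x0 c cv) !mul0r !addr0 mul1r.
Qed.

Lemma bounded_log_ratio (R : realType) (V : choiceType) (K : oriented_complex V)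
    (P Q : V -> circle R) :
  [bounded ratio_map P Q p | p in carrier K P] ->
  exists C, forall v, log_ratio P Q v < C.
Proof.
move=> /ex_strict_bound_gt0[M M0 ltM]; exists (ln M) => v.
have [p pP pv] := ratio_map_vertex K P Q v.
rewrite /log_ratio ltr_ln ?posrE ?divr_gt0 ?radius_gt0 // -pv.
by apply: le_lt_trans (ltM p pP); exact: ler_norm.
Qed.

Lemma constant_ratio_map (R : realType) (V : choiceType)
    (K : oriented_complex V) (P Q : V -> circle R) :
  (forall u v, log_ratio P Q u = log_ratio P Q v) ->
  constant_on (carrier K P) (ratio_map P Q).
Proof.
move=> same.
have ratio_eq u v : Defs.radius (Q u) / Defs.radius (P u) =
    Defs.radius (Q v) / Defs.radius (P v).
  by apply: ln_inj (same u v); rewrite posrE divr_gt0 ?radius_gt0.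
(* Without vertices the carrier is empty and any constant will do. *)
have [[v _]|noV] := pselect ([set: V] !=set0); last first.
  exists 0 => p [[_ [u _]] _]; exfalso; apply: noV; by exists u.
exists (Defs.radius (Q v) / Defs.radius (P v)) => p [[_ [a [b [c [abc s1 p0]]]]] _].
rewrite /ratio_map (realization_sum _ abc p0).
by rewrite (ratio_eq a v) (ratio_eq b v) (ratio_eq c v) -!mulrDl s1 mul1r.
Qed.

Lemma log_ratioC (R : realType) (V : choiceType) (P Q : V -> circle R) v :
  log_ratio Q P v = - log_ratio P Q v.
Proof.
by rewrite /log_ratio -lnV ?posrE ?divr_gt0 ?radius_gt0 // invf_div.
Qed.

Theorem corollary3p2 (R : realType) (V : choiceType) (K : oriented_complex V)
    (D : set (plane R)) (P Q : V -> circle R) :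
  triangulation K D ->
  recurrent R (edge K) ->
  circle_packing K P ->
  circle_packing K Q ->
  (forall v, angle_sum K P v = angle_sum K Q v) ->
  (~ [bounded ratio_map P Q p | p in carrier K P] /\
   ~ [bounded ratio_map Q P p | p in carrier K Q]) \/
  (constant_on (carrier K P) (ratio_map P Q) /\
   constant_on (carrier K Q) (ratio_map Q P)).
Proof.
move=> [_ _ [_ K_fin K_closed _]] K_rec packP packQ same_angles.
have [sameP|nP] := pselect (forall u v, log_ratio P Q u = log_ratio P Q v).
  right; split; apply: constant_ratio_map => // u v.
  by rewrite !(log_ratioC P Q) (sameP u v).
left; split=> /bounded_log_ratio[C ltC]; apply: nP => u v.
  exact: log_ratio_constant ltC u v.
(* Exchanging the packings changes the sign of the log ratio, which does not affect its being
   constant. *)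
have := log_ratio_constant K_fin K_closed K_rec packQ packP
  (fun v => esym (same_angles v)) ltC u v.
by rewrite !(log_ratioC P Q) => /oppr_inj.
Qed.
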